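(* Consider the one-dimensional viscous Burgers equation $u_t+f(u)_x=\mu u_{xx}$, $f(u)=\frac12u^2$, with constant $\mu>0$ and $u\in\mathcal{D}\subset\mathbb{R}$, and its relaxation system $u_t+v_x=0$, $v_t+(\frac{\mu}{\epsilon}+a^2)u_x=\frac1\epsilon(f(u)-v)$, $\epsilon>0$. Suppose that $$-\sqrt{\mu/\epsilon+a^2}\le f'(u)\le\sqrt{\mu/\epsilon+a^2}\qquad\forall\,u\in\mathcal{D},$$ and that $$\Delta t=\frac{CFL\,\Delta x}{\sqrt{\frac{\mu}{\epsilon}+a^2}},\qquad CFL\in(0,1).$$ Then the first-order upwind type relaxation scheme (defined in the context) has a dissipation property, in the sense that the governing equation of up to first order terms in its modified equation $$\partial_t u_h+\partial_xf(u_h)=\partial_x\left(\left(\mu+\epsilon(a^2-f'(u_h)^2)+\sqrt{\tfrac{\mu}{\epsilon}+a^2}\,\tfrac{\Delta x}{2}-f'(u_h)^2\tfrac{\Delta t}{2}\right)\partial_xu_h\right)-\mu\left(\epsilon+\tfrac32\Delta t\right)\partial_x^2\partial_tu_h+O(\epsilon^{\frac12}\Delta x,\epsilon\Delta t,\Delta x^2,\Delta t^2,\epsilon^2)$$ is dissipative, i.e. for $u_h\in\mathcal{D}$ its diffusion coefficient satisfies $$\mu+\epsilon(a^2-f'(u_h)^2)+\sqrt{\tfrac{\mu}{\epsilon}+a^2}\,\tfrac{\Delta x}{2}-f'(u_h)^2\tfrac{\Delta t}{2}\ge0 .$$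
   Context: Put $U=(u,v)^\top$ and $$F(U)=\begin{pmatrix}v\\(\frac{\mu}{\epsilon}+a^2)u\end{pmatrix},\quad H(U)=\begin{pmatrix}0\\\frac1\epsilon(f(u)-v)\end{pmatrix},\quad M=\begin{pmatrix}0&1\\\frac{\mu}{\epsilon}+a^2&0\end{pmatrix},$$ where $a$ is a constant. The first-order upwind type relaxation scheme: on a uniform mesh of size $\Delta x$ with time step $\Delta t$, with piecewise constant data $U(x,t_n)=U^n_j$ on the $j$-th cell, $$U^{n+1}_j=U^n_j-\frac{\Delta t}{\Delta x}\left(F(U^n_{j+1/2})-F(U^n_{j-1/2})\right)+\Delta t\,H(U^{n+1}_j),$$ $$U^n_{j+1/2}=\tfrac12\left(U^n_j+U^n_{j+1}\right)-\frac{1}{2\sqrt{\mu/\epsilon+a^2}}M\left(U^n_{j+1}-U^n_j\right).$$ The modified equation displayed in the claim is the one obtained by representing the numerical solution by smooth functions $(u_h,v_h)$, Taylor expanding all terms of the scheme at $(x_j,t_n)$, and then eliminating $v_h$ by a Chapman-Enskog expansion for small $\epsilon$; ''dissipative'' refers to non-negativity of the coefficient of the second-order diffusion term $\partial_x(\,\cdot\,\partial_xu_h)$.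
   Formalization: For fixed μ the displayed equation omits μ(ε+Δt/2)∂x(f'(u_h)∂x²u_h); it is proved verbatim for μ≤κε and with this term added for μ≤μ0, in both cases with ε,Δx,Δt≤1 and sqrt(μ/ε+a²)Δx bounded. *)

(* Defs.v *)
From Stdlib Require Export Reals ZArith.
From Coquelicot Require Export Coquelicot.
Open Scope R_scope.

Definition f (w : R) : R := w ^ 2 / 2.

(** The state vector [U = (u, v)^T] is encoded as a pair in [R * R]. *)

Definition lam (mu eps a : R) : R := sqrt (mu / eps + a ^ 2).

Definition F (mu eps a : R) (U : R * R) : R * R :=
  (snd U, (mu / eps + a ^ 2) * fst U).

Definition H (eps : R) (U : R * R) : R * R :=
  (0, / eps * (f (fst U) - snd U)).

Definition M (mu eps a : R) : matrix 2 2 :=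
  mk_matrix 2 2 (fun i j : nat =>
    match i, j with
    | O, S O => 1
    | S O, O => mu / eps + a ^ 2
    | _, _ => 0
    end).

Definition mxv (A : matrix 2 2) (U : R * R) : R * R :=
  (coeff_mat 0 A 0 0 * fst U + coeff_mat 0 A 0 1 * snd U,
   coeff_mat 0 A 1 0 * fst U + coeff_mat 0 A 1 1 * snd U).

Definition interface (mu eps a : R) (Ul Ur : R * R) : R * R :=
  minus (scal (1 / 2) (plus Ul Ur))
        (scal (1 / (2 * lam mu eps a)) (mxv (M mu eps a) (minus Ur Ul))).

(** The scheme relation at cell [j] between the time levels [n] and [n + 1], for
    mesh data [U j n]; it is implicit in the stiff source term. *)
Definition scheme_at (mu eps a dx dt : R) (U : Z -> nat -> R * R)
    (j : Z) (n : nat) : Prop :=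
  let flux i := F mu eps a (interface mu eps a (U i n) (U (i + 1)%Z n)) in
  U j (S n) =
    plus (minus (U j n) (scal (dt / dx) (minus (flux j) (flux (j - 1)%Z))))
         (scal dt (H eps (U j (S n)))).

Definition sample (u v : R -> R -> R) (dx dt x0 t0 : R) (j : Z) (n : nat) : R * R :=
  let x := x0 + IZR j * dx in
  let t := t0 + INR n * dt in
  (u x t, v x t).

(** [w x t] is infinitely differentiable on the strip [0 < t < T], and
    [d_x^m d_t^k w] is bounded there by [K m k]. *)
Definition smooth_bounded (T : R) (K : nat -> nat -> R) (w : R -> R -> R) : Prop :=
  forall x t, 0 < t < T ->
    (forall n, ex_diff_n w n x t) /\
    (forall m k, Rabs (partial_derive m k w x t) <= K m k).

(** Smooth functions whose samples on every translate of the mesh satisfy the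
    scheme.  Requiring all translates (and not one fixed mesh) is what makes the
    Taylor expanded scheme an identity between functions, which may be
    differentiated when [v] is eliminated. *)
Definition represents_scheme (T : R) (K : nat -> nat -> R) (mu eps a dx dt : R)
    (u v : R -> R -> R) : Prop :=
  smooth_bounded T K u /\ smooth_bounded T K v /\
  forall x0 t0 (j : Z) (n : nat),
    0 < t0 + INR n * dt -> t0 + INR (S n) * dt < T ->
    scheme_at mu eps a dx dt (sample u v dx dt x0 t0) j n.

Definition diffusion (mu eps a dx dt w : R) : R :=
  mu + eps * (a ^ 2 - (Derive f w) ^ 2) + lam mu eps a * (dx / 2)
  - (Derive f w) ^ 2 * (dt / 2).

(** Left-hand side minus the explicit part of the right-hand side of
    [d_t u + d_x f(u) = d_x (diffusion(u) d_x u) - mu (eps + 3/2 dt) d_x^2 d_t u]. *)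
Definition residual (mu eps a dx dt : R) (u : R -> R -> R) (x t : R) : R :=
  partial_derive 0 1 u x t + Derive (fun y => f (u y t)) x
  - (Derive (fun y => diffusion mu eps a dx dt (u y t) * partial_derive 1 0 u y t) x
     - mu * (eps + 3 / 2 * dt) * partial_derive 2 1 u x t).

(** A third-order term that the same expansion produces, from
    [d_t f(u) = - f'(u) d_x f(u) + mu f'(u) d_x^2 u + ...].  It is [O(eps^2, eps dt)]
    when [mu = O(eps)], i.e. when the characteristic speed [lam] stays bounded, but
    it is not covered by the remainder below when [mu] is fixed and [eps -> 0]. *)
Definition third_order (mu eps dt : R) (u : R -> R -> R) (x t : R) : R :=
  mu * (eps + dt / 2)
  * Derive (fun y => Derive f (u y t) * partial_derive 2 0 u y t) x.

Definition remainder (eps dx dt : R) : R :=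
  sqrt eps * dx + eps * dt + dx ^ 2 + dt ^ 2 + eps ^ 2.

(** [res = O(eps^(1/2) dx, eps dt, dx^2, dt^2, eps^2)] along all smooth
    representations of solutions of the scheme, with [mu] and [eps] in [regime].
    The constant depends only on bounds for the derivatives of [(u, v)] and on a
    bound [L] for the numerical viscosity [lam dx]: the centred second difference
    contributes [lam dx^3], which is not [O(dx^2)] without such a bound. *)
Definition modified_equation (regime : R -> R -> Prop) (a CFL : R)
    (res : forall mu eps dx dt : R, (R -> R -> R) -> R -> R -> R) : Prop :=
  forall (K : nat -> nat -> R) (L : R), exists C : R,
  forall (mu eps dx dt T : R) (u v : R -> R -> R),
    0 < mu -> 0 < eps <= 1 -> regime mu eps ->
    0 < dx <= 1 -> dt = CFL * dx / lam mu eps a -> dt <= 1 ->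
    lam mu eps a * dx <= L ->
    represents_scheme T K mu eps a dx dt u v ->
    forall x t, 0 < t -> t + dt < T ->
      Rabs (res mu eps dx dt u x t) <= C * remainder eps dx dt.

(* Main.v *)
Require Import Defs.
From Stdlib Require Import Lra Lia.

(** With [l = lam], Taylor expansion of the scheme gives
      [u_t + v_x + dt/2 u_tt - l dx/2 u_xx = O(dx^2 + dt^2)]
    and, after multiplying the second equation by [eps],
      [v = f(u) + dt (f(u)_t - v_t) - eps l^2 u_x - eps v_t + O(remainder)],
    since [eps l dx = O(sqrt eps dx)].  The scheme holds at every point of the
    strip, so it may be differentiated in [x] and [t] before it is expanded, and
    the same two relations hold for the derivatives of [(u, v)].  To leading order
    they read [u_t = - v_x], [v = f(u) - mu u_x] and [u_tt = - v_xt], with errors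
    [O(eps + dt + l dx + dx^2)]; these relations are only used after multiplication
    by [eps] or [dt], where such an error becomes [O(remainder)] because
    [dt l <= dx].  Eliminating [v] yields the modified equation with the extra term
    [mu (eps + dt/2) (f'(u) u_xx)_x].  The diffusion coefficient is
    [eps (l^2 - f'(u)^2) + (l dx - f'(u)^2 dt) / 2] with [l^2 dt = CFL l dx]. *)

(** * Families of mixed partial derivatives on the strip *)

(** Differentiation becomes an index shift: [m] counts x-derivatives and [k] t-derivatives. Symmetry
    of mixed derivatives is built in, because both shifts act on the same family. *)
Definition jet (T : R) (W : nat -> nat -> R -> R -> R) : Prop :=
  forall m k x t, 0 < t < T ->
    is_derive (fun y => W m k y t) x (W (S m) k x t) /\
    is_derive (fun s => W m k x s) t (W m (S k) x t).

(** In [partial_derive] the x-derivatives are outermost, so the x-shift is immediate. The t-shift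
    has to pass under them by Schwarz's theorem, which needs differentiability in a neighbourhood of
    the point; the strip is open, so one exists. *)
Lemma smooth_bounded_jet (T : R) (K : nat -> nat -> R) (w : R -> R -> R) :
  smooth_bounded T K w -> jet T (fun m k => partial_derive m k w).
Proof.
intros Hw m k x t Ht.
assert (Hex := proj1 (Hw x t Ht) (S (m + k))).
split.
- apply Derive_correct.
  apply (ex_diff_n_ex_deriv_inf_1 (S (m + k))); [lia | exact Hex].
- rewrite <- Derive_partial_derive.
  + apply Derive_correct.
    apply (ex_diff_n_ex_deriv_inf_2 (S (m + k))); [lia | exact Hex].
  + assert (Hd : 0 < Rmin t (T - t)) by (apply Rmin_pos; lra).
    exists (mkposreal _ Hd); simpl; intros y s _ Hs.
    apply Rabs_def2 in Hs.
    assert (H1 := Rmin_l t (T - t)); assert (H2 := Rmin_r t (T - t)).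
    apply Hw; lra.
Qed.

(** * Taylor expansions and finite differences with explicit remainders *)

(** The mean value theorem replaces integration of [c * s ^ n]; it loses the factor [1 / (n + 1)],
    which does not matter for order estimates. Each expansion below follows by differentiating its
    remainder in the step size, which gives the remainder of an expansion one order lower. *)
Lemma mean_value_bound (g g' : R -> R) (d c : R) (n : nat) :
  0 <= d -> g 0 = 0 ->
  (forall s, 0 <= s <= d -> is_derive g s (g' s)) ->
  (forall s, 0 <= s <= d -> Rabs (g' s) <= c * s ^ n) ->
  Rabs (g d) <= c * d ^ S n.
Proof.
intros Hd H0 Hder Hb.
destruct (Rle_lt_or_eq_dec _ _ Hd) as [Hpos | <-].
2: { rewrite H0, Rabs_R0; simpl; lra. }
assert (Hc : 0 <= c).
{ assert (H1 := Hb d ltac:(lra)).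
  assert (H2 := Rabs_pos (g' d)).
  assert (H3 := pow_lt d n Hpos).
  apply Rmult_le_reg_r with (d ^ n); lra. }
destruct (MVT_cor2 g g' 0 d Hpos) as [s [Hs Hin]].
{ intros s Hs; apply is_derive_Reals, Hder, Hs. }
rewrite H0, !Rminus_0_r in Hs.
rewrite Hs, Rabs_mult, (Rabs_pos_eq d Hd).
simpl; rewrite (Rmult_comm d), <- Rmult_assoc.
apply Rmult_le_compat_r; [exact Hd |].
apply Rle_trans with (1 := Hb s ltac:(lra)).
apply Rmult_le_compat_l; [exact Hc |].
apply pow_incr; lra.
Qed.

Lemma is_derive_shift (h h' : R -> R) (x s : R) :
  is_derive h (x + s) (h' (x + s)) ->
  is_derive (fun s => h (x + s)) s (h' (x + s)).
Proof.
intros Hh.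
rewrite <- (Rmult_1_l (h' (x + s))).
apply (is_derive_comp h (fun s => x + s)); [exact Hh |].
auto_derive; [exact I | ring].
Qed.

Lemma is_derive_shift_opp (h h' : R -> R) (x s : R) :
  is_derive h (x - s) (h' (x - s)) ->
  is_derive (fun s => h (x - s)) s (- h' (x - s)).
Proof.
intros Hh.
replace (- h' (x - s)) with (-1 * h' (x - s)) by ring.
apply (is_derive_comp h (fun s => x - s)); [exact Hh |].
auto_derive; [exact I | ring].
Qed.

Lemma taylor1 (h h1 : R -> R) (t d c : R) :
  0 <= d ->
  (forall s, t <= s <= t + d -> is_derive h s (h1 s)) ->
  (forall s, t <= s <= t + d -> Rabs (h1 s) <= c) ->
  Rabs (h (t + d) - h t) <= c * d.
Proof.
intros Hd D1 Hb.
rewrite <- (pow_1 d) at 2.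
apply (mean_value_bound (fun s => h (t + s) - h t) (fun s => h1 (t + s))).
- exact Hd.
- rewrite Rplus_0_r; ring.
- intros s Hs.
  rewrite <- (Rminus_0_r (h1 (t + s))).
  apply @is_derive_minus; [| apply @is_derive_const].
  apply is_derive_shift, D1; lra.
- intros s Hs; simpl; rewrite Rmult_1_r; apply Hb; lra.
Qed.

Lemma taylor2 (h h1 h2 : R -> R) (t d c : R) :
  0 <= d ->
  (forall s, t <= s <= t + d -> is_derive h s (h1 s) /\ is_derive h1 s (h2 s)) ->
  (forall s, t <= s <= t + d -> Rabs (h2 s) <= c) ->
  Rabs (h (t + d) - h t - d * h1 t) <= c * d ^ 2.
Proof.
intros Hd D Hb.
apply (mean_value_bound (fun s => h (t + s) - h t - s * h1 t)
         (fun s => h1 (t + s) - h1 t)).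
- exact Hd.
- rewrite Rplus_0_r; ring.
- intros s Hs.
  replace (h1 (t + s) - h1 t) with (h1 (t + s) - 0 - h1 t) by ring.
  apply @is_derive_minus; [apply @is_derive_minus; [| apply @is_derive_const] |].
  + apply is_derive_shift, D; lra.
  + auto_derive; [exact I | ring].
- intros s Hs; rewrite pow_1; apply (taylor1 h1 h2).
  + apply Hs.
  + intros r Hr; apply D; lra.
  + intros r Hr; apply Hb; lra.
Qed.

Lemma taylor3 (h h1 h2 h3 : R -> R) (t d c : R) :
  0 <= d ->
  (forall s, t <= s <= t + d ->
     is_derive h s (h1 s) /\ is_derive h1 s (h2 s) /\ is_derive h2 s (h3 s)) ->
  (forall s, t <= s <= t + d -> Rabs (h3 s) <= c) ->
  Rabs (h (t + d) - h t - d * h1 t - d ^ 2 / 2 * h2 t) <= c * d ^ 3.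
Proof.
intros Hd D Hb.
apply (mean_value_bound (fun s => h (t + s) - h t - s * h1 t - s ^ 2 / 2 * h2 t)
         (fun s => h1 (t + s) - h1 t - s * h2 t)).
- exact Hd.
- rewrite Rplus_0_r; field.
- intros s Hs.
  replace (h1 (t + s) - h1 t - s * h2 t)
    with (h1 (t + s) - 0 - h1 t - s * h2 t) by ring.
  apply @is_derive_minus.
  + apply @is_derive_minus; [apply @is_derive_minus; [| apply @is_derive_const] |].
    * apply is_derive_shift, D; lra.
    * auto_derive; [exact I | ring].
  + auto_derive; [exact I | field].
- intros s Hs; apply (taylor2 h1 h2 h3).
  + apply Hs.
  + intros r Hr; apply D; lra.
  + intros r Hr; apply Hb; lra.
Qed.

(** The even second-order terms of the forward and backward expansions cancel. *)
Lemma central_difference (h h1 h2 h3 : R -> R) (x d c : R) :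
  0 <= d ->
  (forall y, is_derive h y (h1 y) /\ is_derive h1 y (h2 y) /\ is_derive h2 y (h3 y)) ->
  (forall y, Rabs (h3 y) <= c) ->
  Rabs (h (x + d) - h (x - d) - 2 * d * h1 x) <= 2 * c * d ^ 3.
Proof.
intros Hd D Hb.
replace (h (x + d) - h (x - d) - 2 * d * h1 x)
  with ((h (x + d) - h x - d * h1 x - d ^ 2 / 2 * h2 x)
        - (h (x - d) - h x + d * h1 x - d ^ 2 / 2 * h2 x)) by field.
apply Rle_trans with (1 := Rabs_triang _ _); rewrite Rabs_Ropp.
assert (H1 : Rabs (h (x + d) - h x - d * h1 x - d ^ 2 / 2 * h2 x) <= c * d ^ 3)
  by (apply (taylor3 h h1 h2 h3); auto).
assert (Hopp : forall p p' : R -> R, (forall y, is_derive p y (p' y)) ->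
  forall s, is_derive (fun s => p (0 - s)) s (- p' (0 - s)))
  by (intros p p' Hp s; apply is_derive_shift_opp, Hp).
(* The backward expansion at [x] is the forward expansion of the reflected function at [- x]. *)
assert (H2 := taylor3 (fun s => h (0 - s)) (fun s => - h1 (0 - s))
  (fun s => h2 (0 - s)) (fun s => - h3 (0 - s)) (- x) d c Hd).
simpl in H2.
replace (0 - (- x + d)) with (x - d) in H2 by ring.
replace (0 - - x) with x in H2 by ring.
replace (h (x - d) - h x + d * h1 x - d ^ 2 / 2 * h2 x)
  with (h (x - d) - h x - d * - h1 x - d * (d * 1) / 2 * h2 x) by field.
enough (Rabs (h (x - d) - h x - d * - h1 x - d * (d * 1) / 2 * h2 x) <= c * d ^ 3) by lra.
apply H2.
- intros s _; split; [| split].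
  + apply Hopp; intros y; apply D.
  + rewrite <- (Ropp_involutive (h2 (0 - s))).
    apply @is_derive_opp, (Hopp h1 h2); intros y; apply D.
  + apply Hopp; intros y; apply D.
- intros s _; rewrite Rabs_Ropp; apply Hb.
Qed.

(** The derivative of the remainder in the step size is the central-difference remainder of [h1],
    already bounded by a cubic. *)
Lemma second_difference (h h1 h2 h3 h4 : R -> R) (x d c : R) :
  0 <= d ->
  (forall y, is_derive h y (h1 y) /\ is_derive h1 y (h2 y) /\
     is_derive h2 y (h3 y) /\ is_derive h3 y (h4 y)) ->
  (forall y, Rabs (h4 y) <= c) ->
  Rabs (h (x + d) - 2 * h x + h (x - d) - d ^ 2 * h2 x) <= 2 * c * d ^ 4.
Proof.
intros Hd D Hb.
apply (mean_value_bound (fun s => h (x + s) - 2 * h x + h (x - s) - s ^ 2 * h2 x)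
         (fun s => h1 (x + s) - h1 (x - s) - 2 * s * h2 x)).
- exact Hd.
- rewrite Rplus_0_r, Rminus_0_r; ring.
- intros s Hs.
  replace (h1 (x + s) - h1 (x - s) - 2 * s * h2 x)
    with (h1 (x + s) - 0 + - h1 (x - s) - 2 * s * h2 x) by ring.
  apply @is_derive_minus.
  + apply @is_derive_plus; [apply @is_derive_minus; [| apply @is_derive_const] |].
    * apply is_derive_shift, D.
    * apply is_derive_shift_opp, D.
  + auto_derive; [exact I | ring].
- intros s Hs; apply (central_difference h1 h2 h3 h4).
  + apply Hs.
  + intros y; split; [| split]; apply D.
  + exact Hb.
Qed.

(** * The upwind operator: differentiation and consistency *)

(** Both components of the scheme, apart from the source, have this form: [(W, Z, c)] is [(u, v, 1)]
    in the first and [(v, u, l ^ 2)] in the second. Its coefficients are constant, so it commutes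
    with both partial derivatives. *)
Definition upwind_step (l dx dt c : R) (W Z : R -> R -> R) (x t : R) : R :=
  W x (t + dt) - W x t
  + dt / dx * (c * (Z (x + dx) t - Z (x - dx) t) / 2
               - l / 2 * (W (x + dx) t - 2 * W x t + W (x - dx) t)).

(** [is_derive_unique] with the types of the bound variables reduced to [R],
    so that it rewrites in the goals left by [auto_derive]. *)
Lemma Derive_is_derive (h : R -> R) (x h' : R) :
  is_derive h x h' -> Derive (fun y : R => h y) x = h'.
Proof. exact (is_derive_unique h x h'). Qed.

Lemma is_derive_upwind_step_x (l dx dt c : R) (W W' Z Z' : R -> R -> R) (x t : R) :
  (forall y, is_derive (fun y => W y (t + dt)) y (W' y (t + dt))) ->
  (forall y, is_derive (fun y => W y t) y (W' y t)) ->
  (forall y, is_derive (fun y => Z y t) y (Z' y t)) ->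
  is_derive (fun y => upwind_step l dx dt c W Z y t) x
    (upwind_step l dx dt c W' Z' x t).
Proof.
intros H1 H2 H3; unfold upwind_step; auto_derive.
- repeat split; eexists; eauto.
- replace (x + - dx) with (x - dx) by ring.
  rewrite (Derive_is_derive _ _ _ (H1 x)), !(Derive_is_derive _ _ _ (H2 _)),
    !(Derive_is_derive _ _ _ (H3 _)).
  unfold Rdiv; ring.
Qed.

Lemma is_derive_upwind_step_t (l dx dt c : R) (W W' Z Z' : R -> R -> R) (x t : R) :
  is_derive (fun s => W x s) (t + dt) (W' x (t + dt)) ->
  (forall y, is_derive (fun s => W y s) t (W' y t)) ->
  (forall y, is_derive (fun s => Z y s) t (Z' y t)) ->
  is_derive (fun s => upwind_step l dx dt c W Z x s) t
    (upwind_step l dx dt c W' Z' x t).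
Proof.
intros H1 H2 H3; unfold upwind_step; auto_derive.
- repeat split; eexists; eauto.
- rewrite (Derive_is_derive _ _ _ H1), !(Derive_is_derive _ _ _ (H2 _)),
    !(Derive_is_derive _ _ _ (H3 _)).
  unfold Rdiv; ring.
Qed.

Lemma upwind_step_consistency (l dx dt c T B : R) (W Z : nat -> nat -> R -> R -> R)
    (m k : nat) (x t : R) :
  0 < l -> 0 < dx -> 0 < dt -> 0 <= c -> 0 < t -> t + dt < T ->
  jet T W -> jet T Z ->
  (forall y s, 0 < s < T ->
     Rabs (W m (3 + k)%nat y s) <= B /\ Rabs (W (4 + m)%nat k y s) <= B /\
     Rabs (Z (3 + m)%nat k y s) <= B) ->
  Rabs (upwind_step l dx dt c (W m k) (Z m k) x t
        - dt * (W m (S k) x t + dt / 2 * W m (2 + k)%nat x t + c * Z (S m) k x t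
                - l * dx / 2 * W (2 + m)%nat k x t))
  <= dt * (B * (dt ^ 2 + (c + l * dx) * dx ^ 2)).
Proof.
intros Hl Hdx Hdt Hc Ht HtT JW JZ HB.
assert (Ht' : 0 < t < T) by lra.
assert (E1 := taylor3 (W m k x) (W m (S k) x) (W m (2 + k)%nat x)
  (W m (3 + k)%nat x) t dt B (Rlt_le _ _ Hdt)).
assert (E2 := central_difference (fun y => Z m k y t) (fun y => Z (S m) k y t)
  (fun y => Z (2 + m)%nat k y t) (fun y => Z (3 + m)%nat k y t) x dx B (Rlt_le _ _ Hdx)).
assert (E3 := second_difference (fun y => W m k y t) (fun y => W (S m) k y t)
  (fun y => W (2 + m)%nat k y t) (fun y => W (3 + m)%nat k y t)
  (fun y => W (4 + m)%nat k y t) x dx B (Rlt_le _ _ Hdx)).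
specialize (E1 (fun s Hs => conj (proj2 (JW m k x s ltac:(lra)))
  (conj (proj2 (JW m (S k) x s ltac:(lra))) (proj2 (JW m (2 + k)%nat x s ltac:(lra)))))).
specialize (E1 (fun s Hs => proj1 (HB x s ltac:(lra)))).
specialize (E2 (fun y => conj (proj1 (JZ m k y t Ht'))
  (conj (proj1 (JZ (S m) k y t Ht')) (proj1 (JZ (2 + m)%nat k y t Ht'))))).
specialize (E2 (fun y => proj2 (proj2 (HB y t Ht')))).
specialize (E3 (fun y => conj (proj1 (JW m k y t Ht'))
  (conj (proj1 (JW (S m) k y t Ht')) (conj (proj1 (JW (2 + m)%nat k y t Ht'))
     (proj1 (JW (3 + m)%nat k y t Ht')))))).
specialize (E3 (fun y => proj1 (proj2 (HB y t Ht')))).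
cbv beta in E1, E2, E3.
set (r1 := _ - _) in E1; set (r2 := _ - _) in E2; set (r3 := _ - _) in E3.
replace (upwind_step _ _ _ _ _ _ _ _ - _)
  (* The defect splits into the time defect [r1], the flux defect [r2] and the viscosity defect
     [r3]; their bounds of order [dt ^ 3], [dx ^ 3] and [dx ^ 4], times these weights, leave a
     common factor [dt]. *)
  with (r1 + (dt / dx * (c / 2)) * r2 - (dt / dx * (l / 2)) * r3).
2: { unfold upwind_step, r1, r2, r3; field; lra. }
assert (Hq : 0 < dt / dx) by (apply Rdiv_lt_0_compat; lra).
assert (P2 : 0 <= dt / dx * (c / 2)) by (apply Rmult_le_pos; lra).
assert (P3 : 0 <= dt / dx * (l / 2)) by (apply Rmult_le_pos; lra).
apply Rle_trans with (1 := Rabs_triang _ _); rewrite Rabs_Ropp.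
apply Rle_trans with (B * dt ^ 3 + (dt / dx * (c / 2)) * (2 * B * dx ^ 3)
                      + (dt / dx * (l / 2)) * (2 * B * dx ^ 4)).
2: { right; field; lra. }
apply Rplus_le_compat.
- apply Rle_trans with (1 := Rabs_triang _ _).
  apply Rplus_le_compat; [exact E1 |].
  rewrite Rabs_mult, (Rabs_pos_eq _ P2).
  apply Rmult_le_compat_l; assumption.
- rewrite Rabs_mult, (Rabs_pos_eq _ P3).
  apply Rmult_le_compat_l; assumption.
Qed.

Lemma upwind_step_identity_x (l dx dt c T : R) (W Z : nat -> nat -> R -> R -> R)
    (m k : nat) (r r' : R -> R -> R) :
  0 < dt -> jet T W -> jet T Z ->
  (forall x t, 0 < t -> t + dt < T ->
     upwind_step l dx dt c (W m k) (Z m k) x t = r x t) ->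
  (forall x t, 0 < t -> t + dt < T -> is_derive (fun y => r y t) x (r' x t)) ->
  forall x t, 0 < t -> t + dt < T ->
    upwind_step l dx dt c (W (S m) k) (Z (S m) k) x t = r' x t.
Proof.
intros Hdt JW JZ Hr Dr x t Ht HtT.
rewrite <- (Derive_is_derive _ _ _ (Dr x t Ht HtT)).
symmetry; apply Derive_is_derive.
apply is_derive_ext with (fun y => upwind_step l dx dt c (W m k) (Z m k) y t).
{ intros y; apply Hr; assumption. }
apply is_derive_upwind_step_x; intros y; apply JW || apply JZ; lra.
Qed.

Lemma upwind_step_identity_t (l dx dt c T : R) (W Z : nat -> nat -> R -> R -> R)
    (m k : nat) (r r' : R -> R -> R) :
  0 < dt -> jet T W -> jet T Z ->
  (forall x t, 0 < t -> t + dt < T ->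
     upwind_step l dx dt c (W m k) (Z m k) x t = r x t) ->
  (forall x t, 0 < t -> t + dt < T -> is_derive (fun s => r x s) t (r' x t)) ->
  forall x t, 0 < t -> t + dt < T ->
    upwind_step l dx dt c (W m (S k)) (Z m (S k)) x t = r' x t.
Proof.
intros Hdt JW JZ Hr Dr x t Ht HtT.
rewrite <- (Derive_is_derive _ _ _ (Dr x t Ht HtT)).
symmetry; apply Derive_is_derive.
apply is_derive_ext_loc with (fun s => upwind_step l dx dt c (W m k) (Z m k) x s).
(* In time the identity is available only for [0 < s < T - dt], so the two sides are compared on a
   neighbourhood that stays inside this interval. *)
- assert (Hd : 0 < Rmin t (T - dt - t)) by (apply Rmin_pos; lra).
  exists (mkposreal _ Hd); intros s Hs; change (Rabs (s - t) < Rmin t (T - dt - t)) in Hs.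
  apply Rabs_def2 in Hs.
  assert (H1 := Rmin_l t (T - dt - t)); assert (H2 := Rmin_r t (T - dt - t)).
  apply Hr; lra.
- apply is_derive_upwind_step_t; intros; apply JW || apply JZ; lra.
Qed.

Lemma upwind_step_jet_0 (l dx dt c T : R) (W Z : nat -> nat -> R -> R -> R) :
  0 < dt -> jet T W -> jet T Z ->
  (forall x t, 0 < t -> t + dt < T -> upwind_step l dx dt c (W O O) (Z O O) x t = 0) ->
  forall m k x t, 0 < t -> t + dt < T ->
    upwind_step l dx dt c (W m k) (Z m k) x t = 0.
Proof.
intros Hdt JW JZ H0 m k; induction m as [| m IHm].
- induction k as [| k IHk]; [exact H0 |].
  apply (upwind_step_identity_t _ _ _ _ T _ _ _ _ _ (fun _ _ => 0) Hdt JW JZ IHk).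
  intros x t _ _; apply @is_derive_const.
- apply (upwind_step_identity_x _ _ _ _ T _ _ _ _ _ (fun _ _ => 0) Hdt JW JZ IHm).
  intros x t _ _; apply @is_derive_const.
Qed.

(** * From the scheme to identities for the upwind operator *)

Lemma lam_pos (mu eps a : R) : 0 < mu -> 0 < eps -> 0 < lam mu eps a.
Proof.
intros Hmu Heps; apply sqrt_lt_R0.
assert (H1 := pow2_ge_0 a); assert (H2 := Rdiv_lt_0_compat _ _ Hmu Heps); lra.
Qed.

Lemma lam_sqr (mu eps a : R) :
  0 < mu -> 0 < eps -> lam mu eps a ^ 2 = mu / eps + a ^ 2.
Proof.
intros Hmu Heps; apply pow2_sqrt.
assert (H1 := pow2_ge_0 a); assert (H2 := Rdiv_lt_0_compat _ _ Hmu Heps); lra.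
Qed.

(** In both components the matrix term of the interface value, after [F] is applied, contributes
    [l / 2] times a jump, because [l ^ 2 / (2 * l) = l / 2]. Differences of jumps give the second
    difference. The base point of the mesh is free, so the cell [j = 0] at level [n = 0] covers
    every point. *)
Lemma scheme_at_upwind_step (mu eps a dx dt x t : R) (u v : R -> R -> R) :
  0 < mu -> 0 < eps -> 0 < dx ->
  scheme_at mu eps a dx dt (sample u v dx dt x t) 0 0 ->
  upwind_step (lam mu eps a) dx dt 1 u v x t = 0 /\
  upwind_step (lam mu eps a) dx dt (lam mu eps a ^ 2) v u x t
  = dt / eps * (f (u x (t + dt)) - v x (t + dt)).
Proof.
intros Hmu Heps Hdx Hs.
assert (Hl := lam_pos mu eps a Hmu Heps).
assert (Hl2 := lam_sqr mu eps a Hmu Heps).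
unfold scheme_at, sample, interface, F, H, M, mxv in Hs.
rewrite !coeff_mat_bij in Hs by lia.
replace (0 + 1)%Z with 1%Z in Hs by lia.
replace (0 - 1)%Z with (-1)%Z in Hs by lia.
replace (-1 + 1)%Z with 0%Z in Hs by lia.
rewrite <- Hl2 in Hs.
assert (Hs1 := f_equal fst Hs); assert (Hs2 := f_equal snd Hs); clear Hs.
do 2 (unfold minus, plus, opp, scal in Hs1, Hs2; simpl in Hs1, Hs2).
unfold mult in Hs1, Hs2; simpl in Hs1, Hs2.
unfold upwind_step.
replace (x + 0 * dx) with x in * by ring.
replace (t + 1 * dt) with (t + dt) in * by ring.
replace (t + 0 * dt) with t in * by ring.
replace (x + 1 * dx) with (x + dx) in * by ring.
replace (x + -1 * dx) with (x - dx) in * by ring.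
split.
- rewrite Hs1; field; lra.
- rewrite Hs2 at 1; field; lra.
Qed.

Lemma Derive_jet_x (T : R) (W : nat -> nat -> R -> R -> R) (m k : nat) (x t : R) :
  jet T W -> 0 < t < T -> Derive (fun y : R => W m k y t) x = W (S m) k x t.
Proof. intros J Ht; apply (Derive_is_derive (fun y => W m k y t)), J, Ht. Qed.

Lemma Derive_jet_t (T : R) (W : nat -> nat -> R -> R -> R) (m k : nat) (x t : R) :
  jet T W -> 0 < t < T -> Derive (fun s : R => W m k x s) t = W m (S k) x t.
Proof. intros J Ht; apply (Derive_is_derive (fun s => W m k x s)), J, Ht. Qed.

Ltac jet_derive :=
  auto_derive;
  [ repeat split;
    match goal with
    | J : jet _ ?W |- ex_derive (fun y => ?W ?m ?k y ?t) ?x =>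
        exists (W (S m) k x t); apply J; lra
    | J : jet _ ?W |- ex_derive (fun s => ?W ?m ?k ?x s) ?t =>
        exists (W m (S k) x t); apply J; lra
    | |- _ => exact I
    end
  | repeat match goal with
    | J : jet _ ?W |- context [Derive (fun y => ?W _ _ y _)] =>
        rewrite !(Derive_jet_x _ W _ _ _ _ J) by lra
    | J : jet _ ?W |- context [Derive (fun s => ?W _ _ _ s)] =>
        rewrite !(Derive_jet_t _ W _ _ _ _ J) by lra
    end ].

(** These are the x-, xx- and xt-derivatives of the second equation, used to eliminate [v_x], [v_xx]
    and [v_xt]. The source is implicit, hence evaluated at [t + dt]. *)
Lemma flux_step_identities (mu eps a dx dt T : R) (U V : nat -> nat -> R -> R -> R) :
  0 < dt -> jet T U -> jet T V ->
  (forall x t, 0 < t -> t + dt < T ->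
     upwind_step (lam mu eps a) dx dt (lam mu eps a ^ 2) (V O O) (U O O) x t
     = dt / eps * (f (U O O x (t + dt)) - V O O x (t + dt))) ->
  forall x t, 0 < t -> t + dt < T ->
  let step m k := upwind_step (lam mu eps a) dx dt (lam mu eps a ^ 2) (V m k) (U m k) x t in
  let s := t + dt in
  step 1%nat 0%nat = dt / eps * (U 0%nat 0%nat x s * U 1%nat 0%nat x s - V 1%nat 0%nat x s) /\
  step 2%nat 0%nat = dt / eps * (U 1%nat 0%nat x s ^ 2 + U 0%nat 0%nat x s * U 2%nat 0%nat x s - V 2%nat 0%nat x s) /\
  step 1%nat 1%nat =
    dt / eps * (U 0%nat 1%nat x s * U 1%nat 0%nat x s + U 0%nat 0%nat x s * U 1%nat 1%nat x s - V 1%nat 1%nat x s).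
Proof.
intros Hdt JU JV H0.
assert (H1 := upwind_step_identity_x _ _ _ _ T _ _ _ _ _
  (fun x t => dt / eps * (U 0%nat 0%nat x (t + dt) * U 1%nat 0%nat x (t + dt) - V 1%nat 0%nat x (t + dt)))
  Hdt JV JU H0).
cbv beta in H1; lapply H1; clear H1; [intros H1 |].
2: { intros x t Ht HtT; unfold f; jet_derive; f_equal; field. }
assert (H2 := upwind_step_identity_x _ _ _ _ T _ _ _ _ _
  (fun x t => dt / eps * (U 1%nat 0%nat x (t + dt) ^ 2
     + U 0%nat 0%nat x (t + dt) * U 2%nat 0%nat x (t + dt) - V 2%nat 0%nat x (t + dt)))
  Hdt JV JU H1).
cbv beta in H2; lapply H2; clear H2; [intros H2 |].
2: { intros x t Ht HtT; jet_derive; ring. }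
assert (H3 := upwind_step_identity_t _ _ _ _ T _ _ _ _ _
  (fun x t => dt / eps * (U 0%nat 1%nat x (t + dt) * U 1%nat 0%nat x (t + dt)
     + U 0%nat 0%nat x (t + dt) * U 1%nat 1%nat x (t + dt) - V 1%nat 1%nat x (t + dt)))
  Hdt JV JU H1).
cbv beta in H3; lapply H3; clear H3; [intros H3 |].
2: { intros x t Ht HtT; jet_derive; ring. }
intros x t Ht HtT; split; [apply H1 | split; [apply H2 | apply H3]]; assumption.
Qed.

(** * Comparison of the error scales *)

(** [N] bounds [eps * l ^ 2], so that [eps * l * dx] is [O(sqrt eps * dx)];
    [L] bounds the numerical viscosity [l * dx]. *)
Record scales (N L eps dx dt l : R) : Prop := {
  scales_eps : 0 < eps <= 1;
  scales_dx : 0 < dx <= 1;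
  scales_dt : 0 < dt <= 1;
  scales_l : 0 < l;
  scales_N : 1 <= N;
  scales_visc : l * dx <= L;
  scales_stiff : eps * l ^ 2 <= N;
  scales_cfl : dt * l <= dx }.

Definition weak_remainder (eps dx dt l : R) : R := eps + dt + l * dx + dx ^ 2.

Lemma Rabs_mult_le (p q P Q : R) : Rabs p <= P -> Rabs q <= Q -> Rabs (p * q) <= P * Q.
Proof.
intros Hp Hq; rewrite Rabs_mult.
apply Rmult_le_compat; auto using Rabs_pos.
Qed.

Lemma Rabs_minus_le (p q P Q : R) : Rabs p <= P -> Rabs q <= Q -> Rabs (p - q) <= P + Q.
Proof.
intros Hp Hq; apply Rle_trans with (1 := Rabs_triang _ _).
rewrite Rabs_Ropp; apply Rplus_le_compat; assumption.
Qed.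

Lemma Rabs_le_iff (p P : R) : Rabs p <= P <-> - P <= p <= P.
Proof. split; [apply Rabs_le_between | apply Rabs_le_between]. Qed.

Lemma remainder_terms (eps dx dt : R) :
  0 < eps <= 1 -> 0 < dx -> 0 < dt ->
  0 <= sqrt eps * dx <= remainder eps dx dt /\ 0 <= eps * dt <= remainder eps dx dt /\
  0 <= dx ^ 2 <= remainder eps dx dt /\ 0 <= dt ^ 2 <= remainder eps dx dt /\
  0 <= eps ^ 2 <= remainder eps dx dt.
Proof.
intros Heps Hdx Hdt; unfold remainder.
assert (H1 : 0 <= sqrt eps * dx) by (apply Rmult_le_pos; [apply sqrt_pos | lra]).
assert (H2 : 0 <= eps * dt) by (apply Rmult_le_pos; lra).
assert (H3 := pow2_ge_0 dx); assert (H4 := pow2_ge_0 dt); assert (H5 := pow2_ge_0 eps).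
repeat split; lra.
Qed.

(** The square of [sqrt eps * l] is at most [N], and [N <= N ^ 2] since [1 <= N]. *)
Lemma scales_sqrt (N L eps dx dt l : R) :
  scales N L eps dx dt l -> eps * l <= N * sqrt eps.
Proof.
intros []; assert (Hq := sqrt_pos eps); assert (Hqq := pow2_sqrt eps ltac:(lra)).
set (q := sqrt eps) in *; rewrite <- Hqq in *.
assert (Hql : q * l <= N).
{ apply Rsqr_incr_0_var; [unfold Rsqr; nra | lra]. }
nra.
Qed.

(** The mixed term [sqrt eps * dx] is split by the inequality between arithmetic and geometric means
    into [eps] and [dx ^ 2]; the other terms use that [eps] and [dt] are at most 1. *)
Lemma remainder_le_weak (N L eps dx dt l : R) :
  scales N L eps dx dt l -> remainder eps dx dt <= 4 * weak_remainder eps dx dt l.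
Proof.
intros []; unfold remainder, weak_remainder.
assert (Hq := sqrt_pos eps); assert (Hqq := pow2_sqrt eps ltac:(lra)).
set (q := sqrt eps) in *.
assert (H1 : 0 <= (q - dx) ^ 2) by apply pow2_ge_0.
assert (H2 : 0 <= l * dx) by nra.
assert (H3 : eps * dt <= dt) by nra.
assert (H4 : dt ^ 2 <= dt) by nra.
assert (H5 : eps ^ 2 <= eps) by nra.
nra.
Qed.

(** The two products involving [l] are the delicate ones: [eps * l * dx] is controlled by
    [scales_sqrt], and [dt * l * dx] is at most [dx ^ 2] by the CFL bound. *)
Lemma weak_mult_le_remainder (N L eps dx dt l : R) :
  scales N L eps dx dt l ->
  (eps + dt) * weak_remainder eps dx dt l <= (4 + N) * remainder eps dx dt.
Proof.
intros Hs; assert (Hql := scales_sqrt _ _ _ _ _ _ Hs); destruct Hs.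
destruct (remainder_terms eps dx dt) as (H1 & H2 & H3 & H4 & H5); try lra.
assert (H6 : eps * l * dx <= N * (sqrt eps * dx)) by nra.
assert (H7 : dt * l * dx <= dx ^ 2) by nra.
assert (H8 : eps * dx ^ 2 <= dx ^ 2) by nra.
assert (H9 : dt * dx ^ 2 <= dx ^ 2) by nra.
replace ((eps + dt) * weak_remainder eps dx dt l)
  with (eps ^ 2 + 2 * (eps * dt) + dt ^ 2 + eps * l * dx + dt * l * dx
        + eps * dx ^ 2 + dt * dx ^ 2) by (unfold weak_remainder; ring).
assert (H10 : N * (sqrt eps * dx) <= N * (remainder eps dx dt - (eps * dt + dx ^ 2 + dt ^ 2 + eps ^ 2)))
  by (apply Rmult_le_compat_l; [lra | unfold remainder; lra]).
assert (H11 : 0 <= N * (eps * dt + dx ^ 2 + dt ^ 2 + eps ^ 2))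
  by (apply Rmult_le_pos; lra).
assert (H12 : remainder eps dx dt = sqrt eps * dx + eps * dt + dx ^ 2 + dt ^ 2 + eps ^ 2)
  by reflexivity.
lra.
Qed.

(** * Pointwise balances of the two equations and their combination *)

(** Dividing the consistency estimate by [dt] gives the first bound, where [l * dx <= L] absorbs the
    cubic viscosity error. Moving the [utt] and [uxx] terms into the error gives the second. *)
Lemma transport_balance (N L eps dx dt l B ut utt uxx vx : R) :
  scales N L eps dx dt l -> 0 <= B ->
  Rabs (0 - dt * (ut + dt / 2 * utt + 1 * vx - l * dx / 2 * uxx))
    <= dt * (B * (dt ^ 2 + (1 + l * dx) * dx ^ 2)) ->
  Rabs utt <= B -> Rabs uxx <= B ->
  Rabs (ut + vx + dt / 2 * utt - l * dx / 2 * uxx)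
    <= B * (2 + L) * remainder eps dx dt /\
  Rabs (ut + vx) <= 2 * B * weak_remainder eps dx dt l.
Proof.
intros [] HB Hstep Hutt Huxx.
destruct (remainder_terms eps dx dt) as (H1 & H2 & H3 & H4 & H5); try lra.
assert (Hr : Rabs (ut + vx + dt / 2 * utt - l * dx / 2 * uxx)
             <= B * (dt ^ 2 + (1 + l * dx) * dx ^ 2)).
{ apply Rmult_le_reg_l with dt; [lra |].
  apply Rle_trans with (2 := Hstep); right.
  rewrite <- (Rabs_pos_eq dt) at 1 by lra.
  rewrite <- Rabs_mult, <- Rabs_Ropp; f_equal; ring. }
assert (Hld : 0 <= l * dx) by nra.
split.
- apply Rle_trans with (1 := Hr); rewrite Rmult_assoc.
  apply Rmult_le_compat_l; [exact HB |]; nra.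
- assert (E1 := Rabs_mult_le (dt / 2) utt (dt / 2) B ltac:(rewrite Rabs_pos_eq; lra) Hutt).
  assert (E2 := Rabs_mult_le (l * dx / 2) uxx (l * dx / 2) B
                  ltac:(rewrite Rabs_pos_eq; lra) Huxx).
  assert (H6 : dt ^ 2 + (1 + l * dx) * dx ^ 2 <= dt + dx ^ 2 + l * dx).
  { assert (K1 : dt ^ 2 <= dt) by nra.
    assert (K2 : dx ^ 2 <= 1) by nra.
    apply (Rmult_le_compat_l (l * dx) _ _ Hld) in K2; lra. }
  apply (Rmult_le_compat_l B _ _ HB) in H6.
  assert (H7 : 0 <= B * eps) by nra.
  assert (H8 : 0 <= B * dt) by nra.
  assert (H9 : 0 <= B * (l * dx)) by nra.
  assert (H10 : 0 <= B * dx ^ 2) by nra.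
  rewrite Rabs_le_iff in *; unfold weak_remainder; lra.
Qed.

(** Here [g] stands for a derivative of the flux [f(u)], and primes denote values at [t + dt].
    Multiplication by [eps / dt] tames the factor [l ^ 2], since [eps * l ^ 2 <= N]; Taylor
    expansion of [g' - v'] back to time [t] then produces [dt * (gt - vt)]. The value used for [A]
    is [a ^ 2], for which [eps * l ^ 2 - eps * A] is [mu]. *)
Lemma relaxation_balance (N L eps dx dt l B A : R)
    (v v' vt vtt vxx ux g g' gt : R) :
  scales N L eps dx dt l -> 0 <= B -> 0 <= A <= N ->
  Rabs (dt / eps * (g' - v') - dt * (vt + dt / 2 * vtt + l ^ 2 * ux - l * dx / 2 * vxx))
    <= dt * (B * (dt ^ 2 + (l ^ 2 + l * dx) * dx ^ 2)) ->
  Rabs (g' - g - dt * gt) <= B * dt ^ 2 ->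
  Rabs (v' - v - dt * vt) <= B * dt ^ 2 ->
  Rabs vtt <= B -> Rabs vxx <= B -> Rabs vt <= B -> Rabs gt <= B -> Rabs ux <= B ->
  Rabs (v - (g + dt * (gt - vt) - eps * l ^ 2 * ux - eps * vt))
    <= B * (4 + 2 * N + L) * remainder eps dx dt /\
  Rabs (v - (g - (eps * l ^ 2 - eps * A) * ux))
    <= 5 * (B * (4 + 2 * N + L)) * weak_remainder eps dx dt l.
Proof.
intros Hs HB HA Hstep Hg Hv Hvtt Hvxx Hvt Hgt Hux.
assert (Hql := scales_sqrt _ _ _ _ _ _ Hs).
assert (Hw := remainder_le_weak _ _ _ _ _ _ Hs); destruct Hs.
destruct (remainder_terms eps dx dt) as (H1 & H2 & H3 & H4 & H5); try lra.
set (e := vt + dt / 2 * vtt + l ^ 2 * ux - l * dx / 2 * vxx) in *.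
assert (Hr : Rabs (g' - v' - eps * e) <= eps * (B * (dt ^ 2 + (l ^ 2 + l * dx) * dx ^ 2))).
{ replace (g' - v' - eps * e) with (eps / dt * (dt / eps * (g' - v') - dt * e))
    by (field; lra).
  rewrite Rabs_mult, Rabs_pos_eq by (apply Rdiv_le_0_compat; lra).
  replace (eps * (B * (dt ^ 2 + (l ^ 2 + l * dx) * dx ^ 2)))
    with (eps / dt * (dt * (B * (dt ^ 2 + (l ^ 2 + l * dx) * dx ^ 2)))) by (field; lra).
  apply Rmult_le_compat_l; [apply Rdiv_le_0_compat; lra | exact Hstep]. }
assert (Hld : 0 < l * dx) by nra.
assert (H6 : eps * (dt ^ 2 + (l ^ 2 + l * dx) * dx ^ 2) <= (1 + N + L) * remainder eps dx dt).
{ assert (K1 : eps * dt ^ 2 <= remainder eps dx dt) by nra.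
  assert (K2 : eps * l ^ 2 * dx ^ 2 <= N * remainder eps dx dt)
    by (apply Rmult_le_compat; nra).
  assert (K3 : eps * (l * dx) * dx ^ 2 <= L * remainder eps dx dt)
    by (apply Rmult_le_compat; nra).
  lra. }
assert (H7 : eps * l * dx <= N * remainder eps dx dt) by nra.
set (rem := remainder eps dx dt) in *.
apply (Rmult_le_compat_l B _ _ HB) in H6.
apply (Rmult_le_compat_l B _ _ HB) in H7.
assert (H8 : B * (eps * dt) <= B * rem) by (apply Rmult_le_compat_l; lra).
assert (H9 : B * dt ^ 2 <= B * rem) by (apply Rmult_le_compat_l; lra).
assert (E1 := Rabs_mult_le (eps * dt / 2) vtt (eps * dt / 2) B
                ltac:(rewrite Rabs_pos_eq; lra) Hvtt).
assert (E2 := Rabs_mult_le (eps * l * dx / 2) vxx (eps * l * dx / 2) B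
                ltac:(rewrite Rabs_pos_eq; nra) Hvxx).
assert (Hstrong : Rabs (v - (g + dt * (gt - vt) - eps * l ^ 2 * ux - eps * vt))
    <= B * (4 + 2 * N + L) * rem).
{ replace (v - (g + dt * (gt - vt) - eps * l ^ 2 * ux - eps * vt))
    with (- (g' - v' - eps * e) - eps * dt / 2 * vtt + eps * l * dx / 2 * vxx
          + (g' - g - dt * gt) - (v' - v - dt * vt)) by (unfold e; field).
  assert (K1 : 0 <= B * rem) by nra.
  assert (K2 : 0 <= N * (B * rem)) by nra.
  rewrite Rabs_le_iff in *; lra. }
split; [exact Hstrong |].
assert (E3 := Rabs_mult_le dt gt dt B ltac:(rewrite Rabs_pos_eq; lra) Hgt).
assert (E4 := Rabs_mult_le dt vt dt B ltac:(rewrite Rabs_pos_eq; lra) Hvt).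
assert (E5 := Rabs_mult_le eps vt eps B ltac:(rewrite Rabs_pos_eq; lra) Hvt).
assert (E6 := Rabs_mult_le (eps * A) ux (N * eps) B ltac:(rewrite Rabs_pos_eq; nra) Hux).
assert (K1 : B * (4 + 2 * N + L) * rem <= B * (4 + 2 * N + L) * (4 * weak_remainder eps dx dt l))
  by (apply Rmult_le_compat_l; [nra | exact Hw]).
set (w := weak_remainder eps dx dt l) in *.
assert (Hwe : eps + dt <= w) by (unfold w, weak_remainder; nra).
assert (K2 : B * (eps + dt) <= B * w) by (apply Rmult_le_compat_l; lra).
assert (K3 : N * (B * eps) <= N * (B * w))
  by (apply Rmult_le_compat_l; [lra | apply Rmult_le_compat_l; lra]).
assert (K4 : 0 <= B * eps) by nra.
assert (K5 : 0 <= L * (B * w)) by (apply Rmult_le_pos; [lra | apply Rmult_le_pos; lra]).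
assert (K6 : 0 <= N * (B * w)) by (apply Rmult_le_pos; [lra | apply Rmult_le_pos; lra]).
assert (K7 : 0 <= B * dt) by nra.
rewrite Rabs_le_iff in *; lra.
Qed.

(** [r1] and [r3] are the defects of the [u]-equation and of its [t]-derivative,
    [r2] and [r4] those of [v_x] and [v_xt], [r5] and [r6] those of
    [u_t = - f(u)_x + mu u_xx] and of its [x]-derivative; [p] and [q] are [u_x]
    and [u]. *)
Lemma residual_combination (N L eps dx dt l A B X r1 r2 r3 r4 r5 r6 p q : R) :
  scales N L eps dx dt l -> 0 <= A -> 0 <= B ->
  Rabs r1 <= A * remainder eps dx dt ->
  Rabs r2 <= A * remainder eps dx dt ->
  (forall r, r = r3 \/ r = r4 -> Rabs r <= 5 * A * weak_remainder eps dx dt l) ->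
  (forall r, r = r5 \/ r = r6 -> Rabs r <= 10 * A * weak_remainder eps dx dt l) ->
  Rabs p <= B -> Rabs q <= B ->
  X = r1 - r2 - dt / 2 * r3 + dt * r4 + (eps + dt / 2) * (r4 + p * r5 + q * r6) ->
  Rabs X <= (2 * A + (13 + 20 * B) * A * (4 + N)) * remainder eps dx dt.
Proof.
intros Hs HA HB H1 H2 H34 H56 Hp Hq ->.
assert (Hm := weak_mult_le_remainder _ _ _ _ _ _ Hs); destruct Hs.
assert (H3 := H34 r3 (or_introl eq_refl)); assert (H4 := H34 r4 (or_intror eq_refl)).
assert (H5 := H56 r5 (or_introl eq_refl)); assert (H6 := H56 r6 (or_intror eq_refl)).
assert (Hw : 0 <= weak_remainder eps dx dt l) by (unfold weak_remainder; nra).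
set (w := weak_remainder eps dx dt l) in *; set (rem := remainder eps dx dt) in *.
assert (Hd : 0 < dt / 2 < eps + dt) by lra.
assert (He : 0 < eps + dt / 2 < eps + dt) by lra.
assert (G3 := Rabs_mult_le (dt / 2) r3 ((eps + dt) / 2) _ ltac:(rewrite Rabs_pos_eq; lra) H3).
assert (G4 := Rabs_mult_le dt r4 (eps + dt) _ ltac:(rewrite Rabs_pos_eq; lra) H4).
assert (G5 := Rabs_mult_le _ _ _ _ Hp H5).
assert (G6 := Rabs_mult_le _ _ _ _ Hq H6).
assert (G : Rabs (r4 + p * r5 + q * r6) <= (5 + 20 * B) * A * w)
  by (rewrite Rabs_le_iff in *; lra).
apply (Rabs_mult_le (eps + dt / 2) _ (eps + dt) _ ltac:(rewrite Rabs_pos_eq; lra)) in G.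
(* The 13 rounds up 5/2 + 5 + 5, from [r3] and the two occurrences of [r4]; the part [20 * B] comes
   from [p * r5 + q * r6]. *)
assert (Hf : (13 + 20 * B) * A * ((eps + dt) * w) <= (13 + 20 * B) * A * ((4 + N) * rem))
  by (apply Rmult_le_compat_l; [nra | exact Hm]).
assert (Hx : 0 <= A * ((eps + dt) * w))
  by (apply Rmult_le_pos; [lra | apply Rmult_le_pos; lra]).
rewrite Rabs_le_iff in *; lra.
Qed.

(** * The residual as a polynomial in derivatives of the solution *)

Lemma Derive_f (w : R) : Derive f w = w.
Proof. apply Derive_is_derive; unfold f; auto_derive; [exact I | field]. Qed.

Lemma residual_jet (T mu eps a dx dt : R) (u : R -> R -> R) (x t : R) :
  let U m k := partial_derive m k u x t in
  jet T (fun m k => partial_derive m k u) -> 0 < t < T ->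
  residual mu eps a dx dt u x t =
    U O 1%nat + U O O * U 1%nat O
    - ((mu + eps * a ^ 2 + lam mu eps a * dx / 2) * U 2%nat O
       - (eps + dt / 2) * (2 * U O O * U 1%nat O ^ 2 + U O O ^ 2 * U 2%nat O)
       - mu * (eps + 3 / 2 * dt) * U 2%nat 1%nat).
Proof.
intros U J Ht; unfold residual, U; clear U.
set (U := fun m k => partial_derive m k u) in J.
rewrite (Derive_ext _ (fun y => U O O y t ^ 2 / 2)) by reflexivity.
rewrite (Derive_ext (fun y => diffusion _ _ _ _ _ _ * _)
  (fun y => (mu + eps * (a ^ 2 - U O O y t ^ 2) + lam mu eps a * (dx / 2)
             - U O O y t ^ 2 * (dt / 2)) * U 1%nat O y t)).
2: { intros y; unfold diffusion; rewrite Derive_f; reflexivity. }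
rewrite (Derive_is_derive _ _ (U O O x t * U 1%nat O x t)) by (jet_derive; field).
rewrite (Derive_is_derive _ _
  ((mu + eps * a ^ 2 + lam mu eps a * dx / 2) * U 2%nat O x t
   - (eps + dt / 2) * (2 * U O O x t * U 1%nat O x t ^ 2 + U O O x t ^ 2 * U 2%nat O x t)))
  by (jet_derive; field).
reflexivity.
Qed.

Lemma third_order_jet (T mu eps dt : R) (u : R -> R -> R) (x t : R) :
  let U m k := partial_derive m k u x t in
  jet T (fun m k => partial_derive m k u) -> 0 < t < T ->
  third_order mu eps dt u x t =
    mu * (eps + dt / 2) * (U 1%nat O * U 2%nat O + U O O * U 3%nat O).
Proof.
intros U J Ht; unfold third_order, U; clear U.
set (U := fun m k => partial_derive m k u) in J.
rewrite (Derive_ext _ (fun y => U O O y t * U 2%nat O y t)).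
2: { intros y; rewrite Derive_f; reflexivity. }
rewrite (Derive_is_derive _ _ (U 1%nat O x t * U 2%nat O x t + U O O x t * U 3%nat O x t))
  by (jet_derive; ring).
reflexivity.
Qed.

(** * Uniform bounds and expansion along smooth representations *)

Lemma finite_bound (K : nat -> R) (n : nat) :
  exists B, forall i, (i <= n)%nat -> K i <= B.
Proof.
induction n as [| n [B HB]].
- exists (K O); intros i Hi; replace i with O by lia; lra.
- exists (Rmax B (K (S n))); intros i Hi.
  destruct (Nat.eq_dec i (S n)) as [-> | Hne]; [apply Rmax_r |].
  apply Rle_trans with (2 := Rmax_l _ _); apply HB; lia.
Qed.

Lemma finite_bound2 (K : nat -> nat -> R) (n : nat) :
  exists B, 1 <= B /\ forall i j, (i <= n)%nat -> (j <= n)%nat -> K i j <= B.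
Proof.
assert (HB : forall p, exists B, forall i j, (i <= p)%nat -> (j <= n)%nat -> K i j <= B).
{ induction p as [| p [B HB]].
  - destruct (finite_bound (K O) n) as [B HB]; exists B; intros i j Hi Hj.
    replace i with O by lia; apply HB, Hj.
  - destruct (finite_bound (K (S p)) n) as [B' HB']; exists (Rmax B B'); intros i j Hi Hj.
    destruct (Nat.eq_dec i (S p)) as [-> | Hne].
    + apply Rle_trans with (2 := Rmax_r _ _); apply HB', Hj.
    + apply Rle_trans with (2 := Rmax_l _ _); apply HB; lia. }
destruct (HB n) as [B HBn]; exists (Rmax 1 B); split; [apply Rmax_l |].
intros i j Hi Hj; apply Rle_trans with (2 := Rmax_r _ _); apply HBn; assumption.
Qed.

Lemma transport_expansion (N L B eps dx dt l T : R) (U V : nat -> nat -> R -> R -> R) :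
  scales N L eps dx dt l -> jet T U -> jet T V ->
  (forall m k x t, (m <= 6)%nat -> (k <= 6)%nat -> 0 < t < T ->
     Rabs (U m k x t) <= B /\ Rabs (V m k x t) <= B) ->
  (forall x t, 0 < t -> t + dt < T -> upwind_step l dx dt 1 (U O O) (V O O) x t = 0) ->
  forall m k x t, (m <= 1)%nat -> (k <= 1)%nat -> 0 < t -> t + dt < T ->
    Rabs (U m (S k) x t + V (S m) k x t + dt / 2 * U m (2 + k)%nat x t
          - l * dx / 2 * U (2 + m)%nat k x t) <= B * (2 + L) * remainder eps dx dt /\
    Rabs (U m (S k) x t + V (S m) k x t) <= 2 * B * weak_remainder eps dx dt l.
Proof.
intros Hs JU JV HB H0 m k x t Hm Hk Ht HtT.
assert (Hs' := Hs); destruct Hs'.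
assert (HB0 : 0 <= B).
{ apply Rle_trans with (2 := proj1 (HB O O x t ltac:(lia) ltac:(lia) ltac:(lra))).
  apply Rabs_pos. }
apply transport_balance with (N := N); try assumption.
- rewrite <- (upwind_step_jet_0 l dx dt 1 T U V ltac:(lra) JU JV H0 m k x t Ht HtT).
  apply upwind_step_consistency with T; try assumption; try lra.
  intros y s Hss; split; [| split]; apply HB; lia || assumption.
- apply HB; lia || lra.
- apply HB; lia || lra.
Qed.

(** Keeping the source as an abstract function [g] of time lets one argument serve [f(u)_x],
    [f(u)_xx] and [f(u)_xt]. *)
Lemma relaxation_expansion (N L B eps dx dt l A T : R) (U V : nat -> nat -> R -> R -> R)
    (g gt gtt : R -> R) (m k : nat) (x t : R) :
  scales N L eps dx dt l -> 0 <= A <= N -> jet T U -> jet T V ->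
  (forall m k x t, (m <= 6)%nat -> (k <= 6)%nat -> 0 < t < T ->
     Rabs (U m k x t) <= B /\ Rabs (V m k x t) <= B) ->
  (m <= 2)%nat -> (k <= 1)%nat -> 0 < t -> t + dt < T ->
  upwind_step l dx dt (l ^ 2) (V m k) (U m k) x t
    = dt / eps * (g (t + dt) - V m k x (t + dt)) ->
  (forall s, 0 < s < T -> is_derive g s (gt s) /\ is_derive gt s (gtt s)) ->
  (forall s, 0 < s < T -> Rabs (gt s) <= B /\ Rabs (gtt s) <= B) ->
  Rabs (V m k x t - (g t + dt * (gt t - V m (S k) x t) - eps * l ^ 2 * U (S m) k x t
                     - eps * V m (S k) x t))
    <= B * (4 + 2 * N + L) * remainder eps dx dt /\
  Rabs (V m k x t - (g t - (eps * l ^ 2 - eps * A) * U (S m) k x t))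
    <= 5 * (B * (4 + 2 * N + L)) * weak_remainder eps dx dt l.
Proof.
intros Hs HA JU JV HB Hm Hk Ht HtT Hstep Dg Hg.
assert (Hs' := Hs); destruct Hs'.
assert (HB0 : 0 <= B).
{ apply Rle_trans with (2 := proj1 (Hg t ltac:(lra))); apply Rabs_pos. }
apply relaxation_balance with (v' := V m k x (t + dt)) (vtt := V m (2 + k)%nat x t)
  (vxx := V (2 + m)%nat k x t) (g' := g (t + dt)); try assumption.
- rewrite <- Hstep.
  apply upwind_step_consistency with T; try assumption; try lra.
  + nra.
  + intros y s Hss; split; [| split]; apply HB; lia || assumption.
- apply taylor2 with gtt; [lra | |]; intros s Hss; [apply Dg | apply Hg]; lra.
- apply (taylor2 (V m k x) (V m (S k) x) (V m (2 + k)%nat x)); [lra | |]; intros s Hss.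
  + split; apply JV; lra.
  + apply HB; lia || lra.
- apply HB; lia || lra.
- apply HB; lia || lra.
- apply HB; lia || lra.
- apply Hg; lra.
- apply HB; lia || lra.
Qed.

(** The time derivatives of the flux terms are linear in products of two derivatives of [u];
    replacing each product by a variable bounded by [B ^ 2] makes the goal linear. *)
Ltac product_bounds HUU Hss :=
  rewrite Rabs_le_iff;
  repeat match goal with
  | |- context [?U ?m ?k ?x ?s * ?U ?m' ?k' ?x ?s] =>
      let P := fresh "P" in
      assert (P := HUU m k m' k' s ltac:(lia) ltac:(lia) ltac:(lia) ltac:(lia) Hss);
      let p := fresh "p" in
      set (p := U m k x s * U m' k' x s) in *; clearbody p
  end; lra.

(** The factor 8 in [D] is the largest sum of coefficients among the flux derivatives [gt] and
    [gtt], for instance 1 + 3 + 3 + 1 in the third t-derivative of [u * u_x] without its extreme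
    x-order changes, that is in [gtt] for [f(u)_xt]. *)
Lemma expansion_error (N L B mu eps a dx dt T : R) (u v : R -> R -> R) :
  let l := lam mu eps a in
  let D := 8 * B ^ 2 in
  let A := D * (4 + 2 * N + L) in
  let U m k := partial_derive m k u in
  let V m k := partial_derive m k v in
  0 < mu -> scales N L eps dx dt l -> a ^ 2 <= N -> 1 <= B ->
  jet T U -> jet T V ->
  (forall m k x t, (m <= 6)%nat -> (k <= 6)%nat -> 0 < t < T ->
     Rabs (U m k x t) <= B /\ Rabs (V m k x t) <= B) ->
  (forall x t, 0 < t -> t + dt < T -> scheme_at mu eps a dx dt (sample u v dx dt x t) 0 0) ->
  forall x t, 0 < t -> t + dt < T ->
    Rabs (residual mu eps a dx dt u x t - third_order mu eps dt u x t)
    <= (2 * A + (13 + 20 * D) * A * (4 + N)) * remainder eps dx dt.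
Proof.
intros l D A U V Hmu Hs HaN HB JU JV HK Hscheme x t Ht HtT.
assert (Hs' := Hs); destruct Hs' as [Heps Hdx Hdt Hlp HN Hvisc Hstiff Hcfl].
assert (Hl2 : eps * l ^ 2 = mu + eps * a ^ 2)
  by (unfold l; rewrite lam_sqr by lra; field; lra).
assert (HD : B <= D) by (unfold D; nra).
assert (HD0 : 0 <= D) by lra.
assert (HL : 0 < L) by (assert (0 < l * dx) by nra; lra).
assert (HA : 0 <= A) by (unfold A; apply Rmult_le_pos; lra).
assert (Ha : 0 <= a ^ 2 <= N) by (split; [apply pow2_ge_0 | exact HaN]).
assert (HKD : forall m k x t, (m <= 6)%nat -> (k <= 6)%nat -> 0 < t < T ->
     Rabs (U m k x t) <= D /\ Rabs (V m k x t) <= D).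
{ intros m k y s Hm Hk Hss; destruct (HK m k y s Hm Hk Hss); split; lra. }
assert (HUU : forall m k m' k' s, (m <= 6)%nat -> (k <= 6)%nat -> (m' <= 6)%nat ->
  (k' <= 6)%nat -> 0 < s < T -> - B ^ 2 <= U m k x s * U m' k' x s <= B ^ 2).
{ intros m k m' k' s h1 h2 h3 h4 Hss; apply Rabs_le_iff.
  replace (B ^ 2) with (B * B) by ring.
  apply Rabs_mult_le; apply HK; assumption. }
assert (E1 := transport_expansion N L D eps dx dt l T U V Hs JU JV HKD
  (fun x t h h' => proj1 (scheme_at_upwind_step _ _ _ _ _ _ _ _ _ Hmu
     (proj1 Heps) (proj1 Hdx) (Hscheme x t h h')))).
destruct (flux_step_identities mu eps a dx dt T U V (proj1 Hdt) JU JV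
  (fun x t h h' => proj2 (scheme_at_upwind_step _ _ _ _ _ _ _ _ _ Hmu
     (proj1 Heps) (proj1 Hdx) (Hscheme x t h h'))) x t Ht HtT)
  as (I10 & I20 & I11); fold l in I10, I20, I11.
assert (W10 := relaxation_expansion N L D eps dx dt l (a ^ 2) T U V
  (fun s => U 0%nat 0%nat x s * U 1%nat 0%nat x s)
  (fun s => U 0%nat 1%nat x s * U 1%nat 0%nat x s + U 0%nat 0%nat x s * U 1%nat 1%nat x s)
  (fun s => U 0%nat 2%nat x s * U 1%nat 0%nat x s + 2 * (U 0%nat 1%nat x s * U 1%nat 1%nat x s)
            + U 0%nat 0%nat x s * U 1%nat 2%nat x s)
  1 0 x t Hs Ha JU JV HKD ltac:(lia) ltac:(lia) Ht HtT I10).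
assert (W20 := relaxation_expansion N L D eps dx dt l (a ^ 2) T U V
  (fun s => U 1%nat 0%nat x s ^ 2 + U 0%nat 0%nat x s * U 2%nat 0%nat x s)
  (fun s => 2 * (U 1%nat 0%nat x s * U 1%nat 1%nat x s)
            + U 0%nat 1%nat x s * U 2%nat 0%nat x s + U 0%nat 0%nat x s * U 2%nat 1%nat x s)
  (fun s => 2 * (U 1%nat 1%nat x s * U 1%nat 1%nat x s)
            + 2 * (U 1%nat 0%nat x s * U 1%nat 2%nat x s)
            + U 0%nat 2%nat x s * U 2%nat 0%nat x s
            + 2 * (U 0%nat 1%nat x s * U 2%nat 1%nat x s)
            + U 0%nat 0%nat x s * U 2%nat 2%nat x s)
  2 0 x t Hs Ha JU JV HKD ltac:(lia) ltac:(lia) Ht HtT I20).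
assert (W11 := relaxation_expansion N L D eps dx dt l (a ^ 2) T U V
  (fun s => U 0%nat 1%nat x s * U 1%nat 0%nat x s + U 0%nat 0%nat x s * U 1%nat 1%nat x s)
  (fun s => U 0%nat 2%nat x s * U 1%nat 0%nat x s + 2 * (U 0%nat 1%nat x s * U 1%nat 1%nat x s)
            + U 0%nat 0%nat x s * U 1%nat 2%nat x s)
  (fun s => U 0%nat 3%nat x s * U 1%nat 0%nat x s + 3 * (U 0%nat 2%nat x s * U 1%nat 1%nat x s)
            + 3 * (U 0%nat 1%nat x s * U 1%nat 2%nat x s) + U 0%nat 0%nat x s * U 1%nat 3%nat x s)
  1 1 x t Hs Ha JU JV HKD ltac:(lia) ltac:(lia) Ht HtT I11).
lapply W10; clear W10; [intros W10 | intros s Hss; split; jet_derive; ring].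
lapply W20; clear W20; [intros W20 | intros s Hss; split; jet_derive; ring].
lapply W11; clear W11; [intros W11 | intros s Hss; split; jet_derive; ring].
lapply W10; clear W10;
  [intros [W10 W10'] | intros s Hss; split; unfold D; product_bounds HUU Hss].
lapply W20; clear W20;
  [intros [_ W20'] | intros s Hss; split; unfold D; product_bounds HUU Hss].
lapply W11; clear W11;
  [intros [_ W11'] | intros s Hss; split; unfold D; product_bounds HUU Hss].
destruct (E1 0%nat 0%nat x t ltac:(lia) ltac:(lia) Ht HtT) as [T00 T00'].
destruct (E1 1%nat 0%nat x t ltac:(lia) ltac:(lia) Ht HtT) as [_ T10'].
destruct (E1 0%nat 1%nat x t ltac:(lia) ltac:(lia) Ht HtT) as [_ T01'].
cbv beta in *; simpl Nat.add in *.
rewrite Hl2 in *.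
replace (mu + eps * a ^ 2 - eps * a ^ 2) with mu in * by ring.
fold A in W10, W10', W20', W11'.
set (rem := remainder eps dx dt) in *; set (w := weak_remainder eps dx dt l) in *.
assert (Hrem : 0 <= rem).
{ destruct (remainder_terms eps dx dt) as ([h1 h2] & _); [lra .. |]; fold rem in h2; lra. }
assert (Hw : 0 <= w) by (unfold w, weak_remainder; nra).
assert (HDA : D * (2 + L) * rem <= A * rem)
  by (apply Rmult_le_compat_r; [exact Hrem | unfold A; apply Rmult_le_compat_l; lra]).
assert (HDA' : 2 * D * w <= 5 * A * w).
{ apply Rmult_le_compat_r; [exact Hw |].
  assert (D * 1 <= A) by (unfold A; apply Rmult_le_compat_l; lra); lra. }
assert (HU0 := proj1 (HKD 0%nat 0%nat x t ltac:(lia) ltac:(lia) ltac:(lra))).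
assert (HU1 := proj1 (HKD 1%nat 0%nat x t ltac:(lia) ltac:(lia) ltac:(lra))).
rewrite (residual_jet T), (third_order_jet T) by (assumption || lra).
fold l.
(* The two differences left open are [r5] and [r6]: subtracting the leading-order relation for [v_x]
   (or [v_xx]) from that for [u_t + v_x] (or its x-derivative) cancels [v]. *)
eapply (residual_combination N L eps dx dt l A D _ _ _ _ _
  (_ - _) (_ - _) (U 1%nat 0%nat x t) (U 0%nat 0%nat x t) Hs HA HD0
  (Rle_trans _ _ _ T00 HDA) W10).
- intros r [-> | ->]; [exact (Rle_trans _ _ _ T01' HDA') | exact W11'].
- replace (10 * A * weak_remainder eps dx dt l) with (5 * A * w + 5 * A * w)
    by (unfold w; ring).
  intros r [-> | ->]; apply Rabs_minus_le.
  + exact (Rle_trans _ _ _ T00' HDA').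
  + exact W10'.
  + exact (Rle_trans _ _ _ T10' HDA').
  + exact W20'.
- exact HU1.
- exact HU0.
(* The elimination is an exact identity. The coefficients [dt] and [eps + dt / 2] of [r4] add up to
   [eps + 3 / 2 * dt] in front of [mu * u_xxt], while [r5] and [r6] turn [f(u)_xt] into the
   diffusion correction and the third-order term. *)
- unfold U; field.
Qed.

(** Both regimes of the theorem rest on this bound. The constants are fixed before [mu], [eps] and
    the mesh, and depend only on [a], [mu0], [K] and [L]. *)
Lemma represents_scheme_expansion (a CFL mu0 : R) (K : nat -> nat -> R) (L : R) :
  0 < CFL < 1 ->
  exists B C : R, 1 <= B /\ 0 <= C /\
  forall (mu eps dx dt T : R) (u v : R -> R -> R),
    0 < mu <= mu0 -> 0 < eps <= 1 -> 0 < dx <= 1 ->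
    dt = CFL * dx / lam mu eps a -> dt <= 1 -> lam mu eps a * dx <= L ->
    represents_scheme T K mu eps a dx dt u v ->
    forall x t, 0 < t -> t + dt < T ->
      0 < dt /\ 0 < remainder eps dx dt /\
      jet T (fun m k => partial_derive m k u) /\
      (forall m, (m <= 6)%nat -> Rabs (partial_derive m 0 u x t) <= B) /\
      Rabs (residual mu eps a dx dt u x t - third_order mu eps dt u x t)
        <= C * remainder eps dx dt.
Proof.
intros hCFL.
(* The highest order needed is 6 = 2 + 4: the second difference of [v_xx] involves four further
   x-derivatives. *)
destruct (finite_bound2 K 6) as [B [HB HKB]].
(* This dominates [eps * l ^ 2 = mu + eps * a ^ 2] as well as [a ^ 2] and 1. *)
set (N := 1 + Rabs mu0 + a ^ 2).
set (A := 8 * B ^ 2 * (4 + 2 * N + L)).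
set (C := 2 * A + (13 + 20 * (8 * B ^ 2)) * A * (4 + N)).
(* Since [L] is arbitrary, [C] may be negative, hence the maximum with 0. *)
exists B, (Rmax 0 C); split; [exact HB |]; split; [apply Rmax_l |].
intros mu eps dx dt T u v Hmu Heps Hdx Hdt Hdt1 HL (Hu & Hv & Hsch) x t Ht HtT.
assert (Hl := lam_pos mu eps a (proj1 Hmu) (proj1 Heps)).
assert (Hl2 := lam_sqr mu eps a (proj1 Hmu) (proj1 Heps)).
assert (Hdtl : dt * lam mu eps a = CFL * dx) by (rewrite Hdt; field; lra).
assert (Hdt0 : 0 < dt).
{ rewrite Hdt; apply Rdiv_lt_0_compat; [apply Rmult_lt_0_compat; lra | exact Hl]. }
assert (Hmu0 := Rle_abs mu0); assert (Ha := pow2_ge_0 a).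
assert (Hs : scales N L eps dx dt (lam mu eps a)).
{ split; try assumption; try lra.
  - unfold N; lra.
  - rewrite Hl2; replace (eps * (mu / eps + a ^ 2)) with (mu + eps * a ^ 2)
      by (field; lra); unfold N; nra.
  - rewrite Hdtl; nra. }
assert (JU := smooth_bounded_jet _ _ _ Hu); assert (JV := smooth_bounded_jet _ _ _ Hv).
assert (HK : forall m k x t, (m <= 6)%nat -> (k <= 6)%nat -> 0 < t < T ->
  Rabs (partial_derive m k u x t) <= B /\ Rabs (partial_derive m k v x t) <= B).
{ intros m k y s Hm Hk Hss; split; apply Rle_trans with (2 := HKB m k Hm Hk);
    [apply Hu | apply Hv]; exact Hss. }
assert (Hrem : 0 < remainder eps dx dt).
{ destruct (remainder_terms eps dx dt) as (h1 & h2 & h3 & h4 & h5); try lra.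
  apply Rlt_le_trans with (eps * dt); [apply Rmult_lt_0_compat; lra | apply h2]. }
split; [exact Hdt0 |]; split; [exact Hrem |]; split; [exact JU |]; split.
{ intros m Hm; apply HK; lia || lra. }
apply Rle_trans with (C * remainder eps dx dt);
  [| apply Rmult_le_compat_r; [lra | apply Rmax_r]].
apply (expansion_error N L B mu eps a dx dt T u v); try assumption; try lra.
- unfold N; assert (Hp := Rabs_pos mu0); lra.
- intros y s Hs0 Hs1; apply Hsch; simpl; lra.
Qed.

(** * Non-negativity of the diffusion coefficient and conclusion *)

Lemma diffusion_nonneg (mu eps a CFL dx dt w : R) :
  0 < CFL < 1 -> 0 < mu -> 0 < eps -> 0 < dx -> dt = CFL * dx / lam mu eps a ->
  - lam mu eps a <= Derive f w <= lam mu eps a ->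
  0 <= diffusion mu eps a dx dt w.
Proof.
intros hCFL Hmu Heps Hdx Hdt Hw.
assert (Hl := lam_pos mu eps a Hmu Heps); assert (Hl2 := lam_sqr mu eps a Hmu Heps).
unfold diffusion; set (l := lam mu eps a) in *; set (d := Derive f w) in *.
assert (Hd : d ^ 2 <= l ^ 2) by nra.
assert (Hmu' : mu + eps * (a ^ 2 - d ^ 2) = eps * (l ^ 2 - d ^ 2))
  by (rewrite Hl2; field; lra).
assert (Hdt' : l ^ 2 * dt = CFL * (l * dx)) by (rewrite Hdt; field; lra).
assert (Hdt0 : 0 < dt).
{ rewrite Hdt; apply Rdiv_lt_0_compat; [apply Rmult_lt_0_compat; lra | exact Hl]. }
assert (Hldx : 0 < l * dx) by (apply Rmult_lt_0_compat; lra).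
(* The subcharacteristic bound settles the relaxation part; together with [CFL < 1] it settles the
   part caused by the discretisation. *)
assert (H1 : 0 <= eps * (l ^ 2 - d ^ 2)) by (apply Rmult_le_pos; lra).
assert (H2 : d ^ 2 * dt <= l ^ 2 * dt) by (apply Rmult_le_compat_r; lra).
assert (H3 : CFL * (l * dx) <= l * dx) by nra.
lra.
Qed.

Theorem proposition3p2 (a CFL : R) (hCFL : 0 < CFL < 1) :
  (forall kappa : R,
     modified_equation (fun mu eps => mu <= kappa * eps) a CFL
       (fun mu eps dx dt u x t => residual mu eps a dx dt u x t)) /\
  (forall mu0 : R,
     modified_equation (fun mu eps => mu <= mu0) a CFL
       (fun mu eps dx dt u x t =>
          residual mu eps a dx dt u x t - third_order mu eps dt u x t)) /\
  (forall (mu eps dx dt : R) (D : R -> Prop),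
     0 < mu -> 0 < eps -> 0 < dx ->
     dt = CFL * dx / lam mu eps a ->
     (forall w, D w -> - lam mu eps a <= Derive f w <= lam mu eps a) ->
     forall w, D w -> 0 <= diffusion mu eps a dx dt w).
Proof.
split; [| split].
- intros kappa K L.
  destruct (represents_scheme_expansion a CFL kappa K L hCFL) as (B & C & HB & HC & Hexp).
  (* The added part bounds the third-order term: [mu <= kappa * eps] makes its coefficient at most
     [kappa] times the remainder, and each of its two products of derivatives is at most [B ^ 2]. *)
  exists (C + kappa * (2 * B ^ 2)).
  intros mu eps dx dt T u v Hmu Heps Hreg Hdx Hdt Hdt1 HL Hrep x t Ht HtT.
  assert (Hkappa : 0 < kappa) by nra.
  destruct (Hexp mu eps dx dt T u v) with (x := x) (t := t)
    as (Hdt0 & Hrem & JU & HU & Herr); try assumption.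
  { split; [exact Hmu | nra]. }
  set (r := residual mu eps a dx dt u x t) in *.
  replace r with ((r - third_order mu eps dt u x t) + third_order mu eps dt u x t) by ring.
  apply Rle_trans with (1 := Rabs_triang _ _); rewrite Rmult_plus_distr_r.
  apply Rplus_le_compat; [exact Herr |].
  rewrite (third_order_jet T) by (assumption || lra).
  destruct (remainder_terms eps dx dt) as (h1 & h2 & h3 & h4 & h5); try lra.
  assert (Hc : Rabs (mu * (eps + dt / 2)) <= kappa * remainder eps dx dt).
  { rewrite Rabs_pos_eq by (apply Rmult_le_pos; lra).
    apply Rle_trans with (kappa * eps * (eps + dt / 2)).
    - apply Rmult_le_compat_r; lra.
    - rewrite Rmult_assoc; apply Rmult_le_compat_l; [lra |].
      unfold remainder; unfold remainder in h2; lra. }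
  replace (kappa * (2 * B ^ 2) * remainder eps dx dt)
    with (kappa * remainder eps dx dt * (B * B + B * B)) by ring.
  apply Rabs_mult_le; [exact Hc |].
  apply Rle_trans with (1 := Rabs_triang _ _).
  apply Rplus_le_compat; apply Rabs_mult_le; apply HU; lia.
- intros mu0 K L.
  destruct (represents_scheme_expansion a CFL mu0 K L hCFL) as (B & C & HB & HC & Hexp).
  exists C.
  intros mu eps dx dt T u v Hmu Heps Hreg Hdx Hdt Hdt1 HL Hrep x t Ht HtT.
  apply (Hexp mu eps dx dt T u v); try assumption; lra.
- intros mu eps dx dt D Hmu Heps Hdx Hdt HD w Hw.
  apply (diffusion_nonneg _ _ _ CFL); auto.
Qed.
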